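(* Let $\{x^k\},\{\lambda^k\},\{w^k\},\{\rho_k\}$ be sequences generated by the augmented Lagrangian method (described in the context). Assume that (i) $F$ is bounded and pseudomonotone, (ii) $\Phi$ is weakly Mosco-continuous, (iii) $G$ is $\mathcal{K}_\infty$-concave with respect to $y$, (iv) the function $(x,y)\mapsto d_{\mathcal{K}}(G(x,y))$ is weakly sequentially lower semicontinuous on $X\times X$, and (v) $x^{k+1}\in C$ and $\varepsilon^{k+1}-\mathcal{L}_{\rho_k}(x^{k+1},w^k)\in\mathcal{N}_C(x^{k+1})$ for all $k$, where $\{\varepsilon^k\}\subseteq X^*$ satisfies $\varepsilon^k\to0$. Let $\bar{x}$ be a weak limit point of $\{x^k\}$. If $\Phi(\bar{x})$ is nonempty, then $\bar{x}$ is feasible, i.e. $\bar{x}\in\Phi(\bar{x})$.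
   Context: Setting. $X,Y$ are real Banach spaces; $C\subseteq X$, $K\subseteq Y$ are nonempty closed convex sets; $F:X\to X^*$; $G:X\times X\to Y$ is Fréchet differentiable with respect to its second argument $y$, with derivative $D_yG(x,y)\in L(X,Y)$; $\Phi(x):=\{y\in C:G(x,y)\in K\}$. $H$ is a real Hilbert space, $i:Y\hookrightarrow H$ is a continuous linear injection with dense range, and $\mathcal{K}\subseteq H$ is a closed convex set with $i^{-1}(\mathcal{K})=K$. Elements of $Y$ are identified with their images in $H$, and $\lambda\in H$ is identified with the element $y\mapsto(\lambda,i(y))_H$ of $Y^*$. $P_{\mathcal{K}}$ and $d_{\mathcal{K}}$ are the projection onto and distance to $\mathcal{K}$ in $H$. $\mathcal{N}_C(x)=\{\psi\in X^*:\langle\psi,s-x\rangle\le0\ \forall s\in C\}$ for $x\in C$. Augmented Lagrangian: for $x\in X$, $\lambda\in H$, $\rho>0$, $\mathcal{L}_\rho(x,\lambda):=F(x)+\rho D_yG(x,x)^*[G(x,x)+\lambda/\rho-P_{\mathcal{K}}(G(x,x)+\lambda/\rho)]\in X^*$. Also $V(x,\lambda,\rho):=\|G(x,x)-P_{\mathcal{K}}(G(x,x)+\lambda/\rho)\|_H$. Augmented Lagrangian method. Given $(x^0,\lambda^0)\in X\times H$, $\rho_0>0$, $\gamma>1$, $\tau\in(0,1)$ and a bounded set $B\subseteq H$, for $k=0,1,2,\dots$: choose $w^k\in B$; compute $x^{k+1}$ as an inexact solution of the variational inequality $x\in C$, $\langle\mathcal{L}_{\rho_k}(x,w^k),y-x\rangle\ge0$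 for all $y\in C$ (the inexactness is that of hypothesis (v)); set $\lambda^{k+1}:=\rho_k[G(x^{k+1},x^{k+1})+w^k/\rho_k-P_{\mathcal{K}}(G(x^{k+1},x^{k+1})+w^k/\rho_k)]$; if $k=0$ or $V(x^{k+1},w^k,\rho_k)\le\tau V(x^k,w^{k-1},\rho_{k-1})$, set $\rho_{k+1}:=\rho_k$, otherwise $\rho_{k+1}:=\gamma\rho_k$. The method is assumed not to terminate, so infinite sequences are generated. Bounded operator: maps bounded sets to bounded sets. Pseudomonotone (Brezis): $T:X\to X^*$ such that, whenever $x^k\rightharpoonup x$ and $\limsup_k\langle T(x^k),x^k-x\rangle\le0$, then $\langle T(x),x-y\rangle\le\liminf_k\langle T(x^k),x^k-y\rangle$ for all $y\in X$. Weak Mosco-continuity of $\Phi$: for every $x\in X$ and $x^k\rightharpoonup x$: (a) for every $y\in\Phi(x)$ there is a sequence $y^k\in\Phi(x^k)$ with $y^k\to y$; (b) whenever $y^k\in\Phi(x^k)$ for all $k$ and $y$ is a weak limit point of $\{y^k\}$, then $y\in\Phi(x)$. A weak limit point is the weak limit of a subsequence. $\mathcal{K}_\infty:=\{h\in H:h+\mathcal{K}\subseteq\mathcal{K}\}$; $G$ is $\mathcal{K}_\infty$-concave with respect to $y$ if $G(x,(1-\alpha)y_1+\alpha y_2)-(1-\alpha)G(x,y_1)-\alpha G(x,y_2)\in\mathcal{K}_\infty$ for all $x,y_1,y_2\in X$, $\alpha\in[0,1]$. *)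

(* Defs.v *)
From HB Require Import structures.
From mathcomp Require Import all_boot all_order all_algebra.
From mathcomp Require Import all_classical all_reals all_analysis.
From mathcomp Require Import ring.

Set Implicit Arguments.
Unset Strict Implicit.
Unset Printing Implicit Defensive.

Import Order.TTheory GRing.Theory Num.Theory.
Import numFieldNormedType.Exports.

Local Open Scope classical_set_scope.
Local Open Scope ring_scope.

Section ContinuousLinear.
Context (R : realType) (V W : normedModType R).

Definition clin_pred : {pred V -> W} :=
  mem [set f : V -> W | linear f /\ continuous f].

(* L(V, W), normed below by the operator norm *)
Record clin := CLin { clin_fun :> V -> W ; _ : clin_fun \in clin_pred }.

HB.instance Definition _ := [isSub for clin_fun].
HB.instance Definition _ := [Choice of clin by <:].

Lemma clin_subsemimod_closed : subsemimod_closed clin_pred.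
Proof.
split; first split.
- by rewrite inE; split=> [a u v|x]; [rewrite scaler0 addr0|exact: cvg_cst].
- move=> f g /[!inE] -[lf cf] [lg cg]; split=> [a u v|x].
    by rewrite !fctE lf lg scalerDr addrACA.
  by apply: cvgD; [exact: cf|exact: cg].
- move=> a f /[!inE] -[lf cf]; split=> [b u v|x].
    by rewrite !fctE lf scalerDr !scalerA mulrC.
  by apply: cvgZl_tmp; exact: cf.
Qed.

HB.instance Definition _ :=
  GRing.SubChoice_isSubLmodule.Build _ _ clin_pred clin clin_subsemimod_closed.

Lemma clin_linear (f : clin) : linear f.
Proof. by case: f => f /= /[!inE] -[]. Qed.

Lemma clin_continuous (f : clin) : continuous f.
Proof. by case: f => f /= /[!inE] -[]. Qed.

HB.instance Definition _ (f : clin) :=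
  GRing.isLinear.Build R V W *:%R f (clin_linear f).

Definition clin_norm (f : clin) : R :=
  sup [set `|f x| | x in [set x : V | `|x| <= 1]].

Let unit_image (f : clin) := [set `|f x| | x in [set x : V | `|x| <= 1]].

Let unit_image_has_sup f : has_sup (unit_image f).
Proof.
split; first by exists `|f 0|, 0 => //=; rewrite normr0.
have /bounded_funP/(_ 1)[M Mf] : bounded_near f (nbhs (0 : V)).
  exact/linear_bounded_continuous/clin_continuous.
by exists M => _ [x /= x1 <-]; exact: Mf.
Qed.

Lemma clin_normP (f : clin) x : `|f x| <= clin_norm f * `|x|.
Proof.
have [->|x0] := eqVneq x 0; first by rewrite linear0 !normr0 mulr0.
have nx0 : 0 < `|x| by rewrite normr_gt0.
have -> : `|f x| = `|f (`|x|^-1 *: x)| * `|x|.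
  by rewrite linearZ/= normrZ normfV normr_id mulrAC mulVf ?gt_eqF// mul1r.
rewrite ler_wpM2r//; apply: ub_le_sup; first by case: (unit_image_has_sup f).
exists (`|x|^-1 *: x) => //=.
by rewrite normrZ normfV normr_id mulVf ?gt_eqF.
Qed.

Lemma clin_normD (f g : clin) : clin_norm (f + g) <= clin_norm f + clin_norm g.
Proof.
apply: ge_sup => [|_ [x /= x1 <-]]; first by case: (unit_image_has_sup (f + g)).
apply: le_trans (ler_normD _ _) _; apply: lerD; apply: ub_le_sup;
  by [case: (unit_image_has_sup f)|case: (unit_image_has_sup g)|exists x].
Qed.

Lemma clin_normZ_le a (f : clin) : clin_norm (a *: f) <= `|a| * clin_norm f.
Proof.
apply: ge_sup => [|_ [x /= x1 <-]]; first by case: (unit_image_has_sup (a *: f)).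
rewrite normrZ ler_wpM2l//; apply: ub_le_sup; last by exists x.
by case: (unit_image_has_sup f).
Qed.

Lemma clin_normZ a (f : clin) : clin_norm (a *: f) = `|a| * clin_norm f.
Proof.
have [->|a0] := eqVneq a 0.
  rewrite normr0 mul0r scale0r; apply/eqP; rewrite eq_le; apply/andP; split.
    by have := clin_normZ_le 0 0; rewrite scale0r normr0 mul0r.
  apply: ub_le_sup; first by case: (unit_image_has_sup 0).
  by exists 0; rewrite /= ?normr0.
apply/eqP; rewrite eq_le clin_normZ_le/=.
have := clin_normZ_le a^-1 (a *: f).
by rewrite scalerA mulVf// scale1r normfV -ler_pdivrMl ?invr_gt0 ?normr_gt0// invrK.
Qed.

Lemma clin_norm_eq0 (f : clin) : clin_norm f = 0 -> f = 0.
Proof.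
move=> f0; apply/val_inj/funext => x /=; apply/eqP; rewrite -normr_le0.
by have := clin_normP f x; rewrite f0 mul0r.
Qed.

HB.instance Definition _ :=
  Lmodule_isNormed.Build R clin clin_normD clin_normZ clin_norm_eq0.

End ContinuousLinear.

Notation dual V := (clin V (_ : realType)^o).

Lemma clin_comp_subproof (R : realType) (U V W : normedModType R)
  (g : clin V W) (f : clin U V) : g \o f \in @clin_pred R U W.
Proof.
rewrite inE; split=> [a u v|x]; first by rewrite /= !linearP.
by apply: continuous_comp; exact: clin_continuous.
Qed.

Definition adjoint (R : realType) (V W : normedModType R)
    (A : clin V W) (psi : dual W) : dual V :=
  CLin (clin_comp_subproof psi A).

HB.mixin Record CompleteNormedModule_isHilbert (R : realType) H
    of CompleteNormedModule R H := {
  inner : {dot H for (@idfun R)} ;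
  innerxx : forall h : H, inner h h = `|h| ^+ 2
}.

#[short(type="hilbertType")]
HB.structure Definition Hilbert (R : realType) :=
  {H of CompleteNormedModule R H & CompleteNormedModule_isHilbert R H}.

Section HilbertDual.
Context (R : realType) (Y : normedModType R) (H : hilbertType R).

Lemma inner_continuous (h : H) : continuous (fun u : H => inner h u : R^o).
Proof.
have innerE u : inner h u = 2^-1 * (`|h + u| ^+ 2 - `|h| ^+ 2 - `|u| ^+ 2).
  have innerC : inner u h = inner h u.
    by rewrite hermitian_subproof expr0 mul1r.
  have innerDr (a b c : H) : inner a (b + c) = inner a b + inner a c.
    exact: linearDr.
  have innerDl (a b c : H) : inner (b + c) a = inner b a + inner c a.
    exact: linearDl.
  by rewrite -!innerxx innerDl !innerDr innerC; field.
rewrite (_ : (fun u => _) =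
  (fun u : H => 2^-1 * (`|h + u| ^+ 2 - `|h| ^+ 2 - `|u| ^+ 2) : R^o)); last first.
  exact/funext.
move=> u; have sqr_cvg (g : H -> H) : {for u, continuous g} ->
    (fun v => `|g v| ^+ 2 : R^o) @ u --> (`|g u| ^+ 2 : R^o).
  by move=> gu; apply: cvgM; apply: cvg_norm; exact: gu.
apply: cvgM; first exact: cvg_cst.
apply: cvgB; last exact: sqr_cvg.
apply: cvgB; last exact: cvg_cst.
by apply: (sqr_cvg (fun v => h + v)); apply: cvgD; [exact: cvg_cst|exact: cvg_id].
Qed.

Lemma to_dual_subproof (i : clin Y H) (h : H) :
  (fun y => inner h (i y) : R^o) \in @clin_pred R Y R^o.
Proof.
rewrite inE; split=> [a u v|y]; first by rewrite !linearP.
apply: (@continuous_comp _ _ _ i (fun u : H => inner h u : R^o)).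
  exact: clin_continuous.
exact: inner_continuous.
Qed.

(* the element y |-> (h, i y)_H of Y^* with which h : H is identified *)
Definition to_dual (i : clin Y H) (h : H) : dual Y := CLin (to_dual_subproof i h).

End HilbertDual.

Section WeakConvergence.
Context (R : realType) (V : normedModType R).

Definition weak_cvg (u : nat -> V) (l : V) : Prop :=
  forall psi : dual V, (psi \o u) @ \oo --> psi l.

Definition weak_limit_point (u : nat -> V) (l : V) : Prop :=
  exists2 phi : nat -> nat,
    {homo phi : m n / (m < n)%N} & weak_cvg (u \o phi) l.

Definition weakly_seq_lsc (f : V -> R) : Prop :=
  forall (u : nat -> V) (l : V), weak_cvg u l ->
    ((f l)%:E <= limn_einf (fun k => (f (u k))%:E))%E.

Definition weakly_mosco_continuous (Phi : V -> set V) : Prop :=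
  forall (x : V) (xk : nat -> V), weak_cvg xk x ->
    (forall y, Phi x y ->
       exists2 yk : nat -> V, (forall k, Phi (xk k) (yk k)) & yk @ \oo --> y) /\
    (forall (yk : nat -> V) (y : V), (forall k, Phi (xk k) (yk k)) ->
       weak_limit_point yk y -> Phi x y).

Definition bounded_operator (T : V -> dual V) : Prop :=
  forall A : set V, bounded_set A -> bounded_set (T @` A).

(* in the sense of Brezis *)
Definition pseudomonotone (T : V -> dual V) : Prop :=
  forall (xk : nat -> V) (x : V), weak_cvg xk x ->
    (limn_esup (fun k => (T (xk k) (xk k - x))%:E) <= 0)%E ->
    forall y, ((T x (x - y))%:E
                 <= limn_einf (fun k => (T (xk k) (xk k - y))%:E))%E.

Definition normal_cone (C : set V) (x : V) : set (dual V) :=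
  [set psi | forall s, C s -> psi (s - x) <= 0].

End WeakConvergence.

Section ConvexSets.
Context (R : realType) (H : normedModType R) (A : set H).

Definition dist_set (h : H) : R := inf [set `|h - a| | a in A].

(* meaningful when A is nonempty, closed and convex in a Hilbert space *)
Definition proj_set (h : H) : H := get [set p | A p /\ `|h - p| = dist_set h].

Definition recession_cone : set H := [set h | [set h + a | a in A] `<=` A].

End ConvexSets.

Section AugmentedLagrangian.
Context (R : realType) (X Y : normedModType R) (H : hilbertType R).
Context (i : clin Y H) (calK : set H).
Context (F : X -> dual X) (G : X -> X -> Y) (DyG : X -> X -> clin X Y).

Definition feasible_map (C : set X) (K : set Y) (x : X) : set X :=
  [set y | C y /\ K (G x y)].

Definition recession_concave : Prop :=
  forall (x y1 y2 : X) (a : R), 0 <= a <= 1 ->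
    recession_cone calK
      (i (G x ((1 - a) *: y1 + a *: y2) - (1 - a) *: G x y1 - a *: G x y2)).

(* G(x,x) + l / rho - P_calK (G(x,x) + l / rho) *)
Definition alm_residual (x : X) (l : H) (rho : R) : H :=
  i (G x x) + rho^-1 *: l - proj_set calK (i (G x x) + rho^-1 *: l).

Definition aug_lagrangian (rho : R) (x : X) (l : H) : dual X :=
  F x + rho *: adjoint (DyG x x) (to_dual i (alm_residual x l rho)).

Definition alm_V (x : X) (l : H) (rho : R) : R :=
  `|i (G x x) - proj_set calK (i (G x x) + rho^-1 *: l)|.

(* The update rules of the method; the inexact solution of the k-th
   variational inequality is described by [alm_inexact]. *)
Record alm_updates (gamma tau : R) (B : set H) (x : nat -> X)
    (lam w : nat -> H) (rho : nat -> R) : Prop := {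
  alm_w : forall k, B (w k) ;
  alm_lam : forall k, lam k.+1 = rho k *: alm_residual (x k.+1) (w k) (rho k) ;
  alm_rho : forall k, rho k.+1 =
    if (k == 0%N) || (alm_V (x k.+1) (w k) (rho k)
                      <= tau * alm_V (x k) (w k.-1) (rho k.-1))
    then rho k else gamma * rho k }.

Definition alm_inexact (C : set X) (x : nat -> X) (w : nat -> H)
    (rho : nat -> R) (eps : nat -> dual X) : Prop :=
  (forall k, C (x k.+1) /\ normal_cone C (x k.+1)
     (eps k.+1 - aug_lagrangian (rho k) (x k.+1) (w k))) /\
  eps @ \oo --> (0 : dual X).

End AugmentedLagrangian.

(* Main.v *)
From HB Require Import structures.
Require Import Defs.
From mathcomp Require Import all_boot all_order all_algebra.
From mathcomp Require Import all_classical all_reals all_analysis.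
From mathcomp Require Import ring lra.

Import Order.TTheory GRing.Theory Num.Theory.
Import numFieldNormedType.Exports.

Local Open Scope classical_set_scope.
Local Open Scope ring_scope.

(** The weak limit point [xbar] is feasible because the violation [V] of the
    constraint tends to zero along the subsequence that converges to it. As [V]
    dominates the distance from [G x x] to [calK], weak lower semicontinuity of
    that distance then gives [calK (i (G xbar xbar))], and [C] is weakly closed.

    If the penalty parameters converge, the update rule makes [V] decrease
    geometrically from some index on ([alm_V_cvg0]).

    Otherwise they tend to infinity. Pick a point of the moving set at [xbar]
    and, by Mosco-continuity, feasible points [y k] for the iterates [u k] that
    converge to it strongly. Testing the variational inequality for [u k] with [y k]
    gives ([alm_residual_bound])
      rho * |r|^2 <= (r, w) + (F u - eps) (y - u),
    where [r] is the residual of the projection onto [calK]. The reason is that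
    concavity puts the linearization [G u u + D_y G u u (y - u)] into [calK]
    ([linearization_mem]), while the residual makes an obtuse angle with the
    directions from the projection into [calK] ([proj_residual_inner_le]).
    Since [F] is bounded and [u], [w], [y], [eps] are bounded sequences, the
    right-hand side grows at most linearly in |r|; so [r], and with it [V],
    tends to zero ([quadratic_bound_cvg0]).

    The functional analysis behind this is: a subgradient of the distance to a
    convex set ([hahn_banach], [convex_separation]), which gives both the weak
    closedness of closed convex sets and, together with the uniform boundedness
    principle on the dual space, the boundedness of weakly convergent
    sequences; and the existence and variational characterization of
    projections in a Hilbert space. *)

Set Implicit Arguments.
Unset Strict Implicit.
Unset Printing Implicit Defensive.

(** * The Hahn-Banach theorem for a convex majorant *)

Section HahnBanach.
Context (R : realType) (V : lmodType R) (p : V -> R).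
Hypothesis p0 : p 0 = 0.
Hypothesis p_convex : forall (a : R) u v, 0 <= a <= 1 ->
  p ((1 - a) *: u + a *: v) <= (1 - a) * p u + a * p v.

(** A linear functional defined on a subspace is encoded by its graph, a set of
    pairs. Since [p 0 = 0], a subspace of [V * R] that stays below [p] contains
    no [(0, s)] with [s != 0], so it is automatically the graph of a function;
    and chains of such sets are closed under plain unions. *)
Definition graph_below (g : set (V * R)) :=
  (forall a u s v t, g (u, s) -> g (v, t) -> g (a *: u + v, a * s + t)) /\
  (forall u s, g (u, s) -> s <= p u).

(** The slope [r] given to the new direction [v] must dominate every backward
    difference quotient and be dominated by every forward one. That each
    backward quotient is below each forward one is the convexity of [p] along
    the segment from [u' - q *: v] to [u + t *: v], at the point where the
    multiples of [v] cancel. *)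
Lemma graph_below_extension g v : graph_below g -> g (0, 0) ->
  exists r, graph_below
    [set y : V * R | exists t, g (y.1 - t *: v, y.2 - t * r)].
Proof.
move=> [g_lin g_le] g00.
pose lower := [set l | exists u s q,
  [/\ g (u, s), 0 < q & l = (s - p (u - q *: v)) / q]].
have lower_le u s t l : g (u, s) -> 0 < t -> lower l ->
    l <= (p (u + t *: v) - s) / t.
  move=> gus t0 [u' [s' [q [gus' q0 ->]]]].
  have tq0 : 0 < t + q by rewrite addr_gt0.
  have mem : g (((t / (t + q)) *: u' + (q / (t + q)) *: u),
                (t / (t + q)) * s' + (q / (t + q)) * s).
    apply: (g_lin) => //.
    by have := g_lin (q / (t + q)) _ _ _ _ gus g00; rewrite !addr0.
  have := @p_convex (q / (t + q)) (u' - q *: v) (u + t *: v).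
  have -> : 1 - q / (t + q) = t / (t + q) by field; rewrite gt_eqF.
  rewrite divr_ge0 ?(ltW q0) ?(ltW tq0)//= ler_pdivrMr// mul1r lerDr (ltW t0).
  move=> /(_ isT).
  have -> : (t / (t + q)) *: (u' - q *: v) + (q / (t + q)) *: (u + t *: v) =
            (t / (t + q)) *: u' + (q / (t + q)) *: u.
    rewrite scalerBr scalerDr !scalerA addrACA -[RHS]addr0; congr (_ + _).
    rewrite -scaleNr -scalerDl [X in X *: _](_ : _ = 0) ?scale0r//.
    by field; rewrite gt_eqF.
  move: (g_le _ _ mem) => /le_trans/[apply].
  rewrite [_ / q <= _]ler_pdivrMr// [X in _ -> _ <= X]mulrAC.
  rewrite [_ <= _ / t]ler_pdivlMr//.
  rewrite [X in X <= _ -> _](_ : _ = (t * s' + q * s) / (t + q)); last first.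
    by field; rewrite gt_eqF.
  rewrite [X in _ <= X -> _](_ : _ =
     (t * p (u' - q *: v) + q * p (u + t *: v)) / (t + q)); last first.
    by field; rewrite gt_eqF.
  rewrite ler_pM2r ?invr_gt0//; lra.
have lower_neq0 : lower !=set0.
  by exists ((0 - p (0 - 1 *: v)) / 1), 0, 0, 1; split.
have lower_ub : has_ubound lower.
  by exists ((p (0 + 1 *: v) - 0) / 1) => l ll; exact: (lower_le 0 0 1).
exists (sup lower); split=> [a u s u' s' [t gt] [t' gt']|u s [t gt]] /=.
  exists (a * t + t').
  have := g_lin a _ _ _ _ gt gt'.
  congr g; congr pair; last by rewrite /=; ring.
  by rewrite scalerBr /= scalerDl !scalerA opprD addrACA.
have [t0|t0|t0] := ltgtP t 0.
- have : lower ((s - t * sup lower - p u) / - t).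
    exists (u - t *: v), (s - t * sup lower), (- t).
    by split; rewrite ?oppr_gt0// scaleNr opprK subrK.
  move=> /(ub_le_sup lower_ub); rewrite ler_pdivrMr ?oppr_gt0//; lra.
- have : sup lower <= (p (u - t *: v + t *: v) - (s - t * sup lower)) / t.
    by apply: ge_sup => // l /(lower_le _ _ _ _ gt t0).
  rewrite subrK ler_pdivlMr//; lra.
- by move: gt; rewrite t0 /= scale0r mul0r !subr0 => /g_le.
Qed.

Lemma graph_below_maximal : exists g, [/\ graph_below g, g (0, 0) &
  forall h, g `<=` h -> graph_below h -> h = g].
Proof.
have [F Fbelow F_chain|g [gb gmax]] := @Zorn_bigcup (V * R)%type graph_below.
  split=> [a u s v t [g Fg gus] [h Fh hvt]|u s [g Fg gus]].
    have [gh|hg] := F_chain _ _ Fg Fh.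
      by exists h => //; apply: (Fbelow _ Fh).1 => //; exact: gh.
    by exists g => //; apply: (Fbelow _ Fg).1 => //; exact: hg.
  exact: (Fbelow _ Fg).2 gus.
have maxE h : g `<=` h -> graph_below h -> h = g.
  move=> gh hb; apply: contrapT => hg; apply: (gmax h) => //; split=> // h_g.
  by apply: hg; apply/seteqP.
(* The empty set also satisfies [graph_below], so [g (0, 0)] needs a proof. *)
have [[[u s] gus]|g0] := pselect (g !=set0).
  exists g; split=> //.
  have := gb.1 (- 1) _ _ _ _ gus gus.
  by rewrite scaleN1r mulN1r !addNr.
exists g; split=> //.
suff <- : [set (0, 0)] = g by [].
apply: maxE => [y gy|]; first by exfalso; apply: g0; exists y.
split=> [a u s v t [-> ->] [-> ->]|u s [-> ->]] //=.
  by rewrite scaler0 mulr0 !addr0.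
by rewrite p0.
Qed.

(** Stated for a convex, rather than sublinear, majorant: this makes the
    subgradients of distance functions directly available, without passing to
    directional derivatives. *)
Theorem hahn_banach : exists2 f : V -> R^o, linear f & forall v, f v <= p v.
Proof.
have [g [gb g00 gmax]] := graph_below_maximal.
have g_total v : exists s, g (v, s).
  have [r hb] := graph_below_extension v gb g00.
  exists r; rewrite -(gmax _ _ hb).
    by exists 1; rewrite /= scale1r mul1r !subrr.
  by move=> [u s] gus; exists 0; rewrite /= scale0r mul0r !subr0.
have g_fun v s t : g (v, s) -> g (v, t) -> s = t.
  have g0_le s' : g (0, s') -> s' <= 0 by move=> /gb.2; rewrite p0.
  have sub s1 s2 : g (v, s1) -> g (v, s2) -> s1 - s2 <= 0.
    move=> g1 g2; apply: g0_le; have := gb.1 (-1) _ _ _ _ g2 g1.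
    by rewrite scaleN1r mulN1r addNr addrC.
  move=> g1 g2; apply/eqP; rewrite eq_le.
  by rewrite -(subr_le0 s) -(subr_le0 t) !sub.
have [f fP] := choice g_total.
exists f => [a u v|v]; last exact: gb.2 (fP v).
by apply: g_fun (fP _) _; exact: gb.1.
Qed.

End HahnBanach.

(** * Bounded linear operators *)

Lemma clin_norm_le (R : realType) (V W : normedModType R) (f : clin V W) M :
  0 <= M -> (forall x, `|f x| <= M * `|x|) -> `|f| <= M.
Proof.
move=> M0 fM; apply: ge_sup; first by exists `|f 0|, 0 => //=; rewrite normr0.
move=> _ [x /= x1 <-]; apply: le_trans (fM x) _.
by rewrite -[leRHS]mulr1 ler_wpM2l.
Qed.

Lemma clin_norm_apply (R : realType) (V W : normedModType R) (f : clin V W) x :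
  `|f x| <= `|f| * `|x|.
Proof. exact: clin_normP. Qed.

Lemma bounded_linear_clin (R : realType) (V W : normedModType R) (g : V -> W) M :
  linear g -> (forall x, `|g x| <= M * `|x|) -> g \in @clin_pred R V W.
Proof.
move=> g_lin gM; pose L := GRing.isLinear.Build _ _ _ _ _ g_lin.
pose gl : {linear V -> W} := HB.pack g L.
rewrite inE; split=> //; apply: (@linear_bounded_continuous _ _ _ gl).1.
apply/bounded_funP => r; exists (`|M| * r) => x xr; apply: le_trans (gM x) _.
by apply: le_trans (ler_wpM2l _ xr); rewrite ?ler_wpM2r ?ler_norm.
Qed.

(** * Distance to a convex set and separation *)

Lemma convex_setP (R : realType) (V : lmodType R) (A : set V) :
  convex_set A -> forall (t : R) a b, 0 <= t <= 1 -> A a -> A b ->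
  A ((1 - t) *: a + t *: b).
Proof.
move=> cA t a b /andP[t0 t1] /mem_set Aa /mem_set Ab.
have := cA b a (Itv01 t0 t1) Ab Aa; rewrite inE /=.
by rewrite addrC.
Qed.

Section Distance.
Context (R : realType) (V : normedModType R) (A : set V).

Lemma dist_set_ge0 h : 0 <= dist_set A h.
Proof.
have [A0|/set0P A0] := eqVneq A set0.
  by rewrite /dist_set A0 image_set0 inf0.
by apply: lb_le_inf => [|_ [a _ <-]//]; exact: image_nonempty.
Qed.

Lemma dist_set_le h a : A a -> dist_set A h <= `|h - a|.
Proof.
move=> Aa; apply: ge_inf; last by exists a.
by exists 0 => _ [b _ <-].
Qed.

Lemma dist_set_approx h e : A !=set0 -> 0 < e ->
  exists2 a, A a & `|h - a| < dist_set A h + e.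
Proof.
move=> A0 e0.
have [|_ [a Aa <-] ha] := @inf_adherent _ [set `|h - a| | a in A] e e0.
  by split; [exact: image_nonempty|exists 0 => _ [b _ <-]].
by exists a.
Qed.

Lemma dist_set_triangle h k : A !=set0 ->
  dist_set A (h + k) <= dist_set A h + `|k|.
Proof.
move=> A0; apply/ler_addgt0Pr => e e0; have [a Aa ha] := dist_set_approx h A0 e0.
apply: le_trans (dist_set_le _ Aa) _.
rewrite addrAC; apply: le_trans (ler_normD _ _) _.
by rewrite [leRHS]addrAC lerD2r ltW.
Qed.

Lemma dist_set_convex (t : R) h k : A !=set0 -> convex_set A -> 0 <= t <= 1 ->
  dist_set A ((1 - t) *: h + t *: k) <=
  (1 - t) * dist_set A h + t * dist_set A k.
Proof.
move=> A0 cA t01; apply/ler_addgt0Pr => e e0.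
have [a Aa ha] := dist_set_approx h A0 e0.
have [b Ab kb] := dist_set_approx k A0 e0.
apply: le_trans (dist_set_le _ (convex_setP cA t01 Aa Ab)) _.
rewrite opprD addrACA -!scalerBr; apply: le_trans (ler_normD _ _) _.
case/andP: t01 => t0 t1.
rewrite !normrZ (ger0_norm t0) ger0_norm ?subr_ge0//.
rewrite (_ : _ + e = (1 - t) * (dist_set A h + e) + t * (dist_set A k + e)).
  by rewrite lerD// ler_wpM2l ?subr_ge0// ltW.
by ring.
Qed.

Lemma closed_dist_set0 h : A !=set0 -> closed A -> dist_set A h <= 0 -> A h.
Proof.
move=> A0 clA d0; apply: clA => U /nbhs_ballP[e /= e0 eU].
have [a Aa ha] := dist_set_approx h A0 e0.
exists a; split=> //; apply: eU; rewrite -ball_normE /=.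
by apply: lt_le_trans ha _; rewrite gerDr.
Qed.

(** [f] is a subgradient at [x0] of the distance to [A], which is convex and
    1-Lipschitz and vanishes on [A]. With [A] reduced to the origin, this yields
    a functional that attains the norm of [x0]. *)
Theorem convex_separation x0 : A !=set0 -> convex_set A ->
  exists2 f : dual V, forall h, `|f h| <= `|h| &
    forall a, A a -> dist_set A x0 <= f (x0 - a).
Proof.
move=> A0 cA; pose p h := dist_set A (x0 + h) - dist_set A x0.
have p_lip h : p h <= `|h| by rewrite /p lerBlDl dist_set_triangle.
have p_convex t u v : 0 <= t <= 1 ->
    p ((1 - t) *: u + t *: v) <= (1 - t) * p u + t * p v.
  move=> t01; have := dist_set_convex (x0 + u) (x0 + v) A0 cA t01.
  rewrite !scalerDr addrACA -scalerDl subrK scale1r /p; lra.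
have p0 : p 0 = 0 by rewrite /p addr0 subrr.
have [f f_lin f_le] := hahn_banach p0 p_convex.
have fN h : f (- h) = - f h.
  have f0 : f 0 = 0.
    by have := f_lin (-1) 0 0; rewrite scaler0 addr0 scaleN1r addNr.
  by have := f_lin (-1) h 0; rewrite f0 !addr0 !scaleN1r.
have f_norm h : `|f h| <= `|h|.
  rewrite ler_norml; apply/andP; split; last exact: le_trans (f_le _) (p_lip _).
  rewrite lerNl -normrN; apply: le_trans (p_lip _).
  by rewrite -[leLHS]fN.
have f_clin : f \in @clin_pred R V R^o.
  by apply: (@bounded_linear_clin _ _ _ _ 1) => // h; rewrite mul1r.
exists (CLin f_clin) => // a Aa /=.
have := f_le (a - x0); rewrite /p subrKC.
have -> : dist_set A a = 0.
  apply/eqP; rewrite eq_le dist_set_ge0 andbT.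
  by rewrite (le_trans (dist_set_le _ Aa))// subrr normr0.
have -> : f (a - x0) = - f (x0 - a) by rewrite -fN opprB.
by rewrite sub0r lerN2.
Qed.

End Distance.

(** * Completeness of spaces of operators and weak convergence *)

Section CompleteDual.
Context (R : realType) (V : normedModType R) (W : completeNormedModType R).

(** The limit of a Cauchy filter of operators is built pointwise; the estimate
    [`|f0 x - f x| <= e * `|x|] on a member of the filter passes to the
    pointwise limit, which makes the limit bounded and the convergence hold for
    the operator norm. *)
Lemma clin_complete (F : set_system (clin V W)) :
  ProperFilter F -> cauchy F -> cvg F.
Proof.
move=> FF F_cauchy.
have F_near (e : R) : 0 < e -> exists f0 : clin V W,
    F [set f : clin V W | forall x, `|f0 x - f x| <= e * `|x|].
  move=> e0; have [f0 Ff0] := (cauchyP F).1 F_cauchy e e0.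
  exists f0; apply: filterS Ff0 => f; rewrite -ball_normE /= => ff0 x.
  apply: le_trans (clin_norm_apply (f0 - f) x) _.
  by rewrite ler_wpM2r// ltW.
have F_ptw x : cvg ((fun f : clin V W => f x) @ F).
  apply: cauchy_cvg; apply: cauchy_exP => e e0.
  have x1_gt0 : 0 < `|x| + 1 by rewrite ltr_wpDl.
  have [f0 Ff0] := F_near (e / (`|x| + 1)) (divr_gt0 e0 x1_gt0).
  exists (f0 x); suff : F [set f : clin V W | ball (f0 x) e (f x)] by [].
  apply: filterS Ff0 => f ff0; rewrite /= -ball_normE /=.
  apply: le_lt_trans (ff0 x) _.
  by rewrite mulrAC ltr_pdivrMr// ltr_pM2l// ltrDl.
pose g x := lim ((fun f : clin V W => f x) @ F).
have gE x : (fun f : clin V W => f x) @ F --> g x by exact: F_ptw.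
have g_lin : linear g.
  move=> a u v.
  have lim_auv : (fun f : clin V W => f (a *: u + v)) @ F --> a *: g u + g v.
    rewrite (_ : (fun f : clin V W => _) =
                 (fun f : clin V W => a *: f u + f v)); last first.
      by apply/funext => f; rewrite linearP.
    by apply: cvgD; [apply: cvgZ; [exact: cvg_cst|exact: gE]|exact: gE].
  by apply: cvg_unique (gE _) lim_auv => //; exact: norm_hausdorff.
have g_near f0 (e : R) :
    F [set f : clin V W | forall x, `|f0 x - f x| <= e * `|x|] ->
    forall x, `|f0 x - g x| <= e * `|x|.
  move=> Ff0 x.
  have f0g : (fun f : clin V W => `|f0 x - f x|) @ F --> `|f0 x - g x|.
    by apply: cvg_norm; apply: cvgB => //; exact: cvg_cst.
  by apply: (cvgr_to_le f0g); apply: filterS Ff0 => f; exact.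
have g_clin : g \in @clin_pred R V W.
  have [f0 /g_near f0g] := F_near 1 ltr01.
  apply: (@bounded_linear_clin _ _ _ _ (1 + `|f0|)) => // x.
  rewrite -[g x](subKr (f0 x)); apply: le_trans (ler_normB _ _) _.
  rewrite mulrDl addrC lerD ?clin_norm_apply//.
apply/cvg_ex; exists (CLin g_clin); apply/cvgrPdist_le => e e0.
have [|f0 Ff0] := F_near (e / 2); first by rewrite divr_gt0.
apply: filterS (Ff0) => f ff0; apply: clin_norm_le; first exact: ltW.
move=> x; change (`|g x - f x| <= e * `|x|).
have -> : g x - f x = (f0 x - f x) - (f0 x - g x).
  by rewrite opprB [RHS]addrC subrKA.
apply: le_trans (ler_normB _ _) _.
rewrite [e]splitr mulrDl lerD//.
exact: g_near.
Qed.

HB.instance Definition _ := Uniform_isComplete.Build (clin V W) clin_complete.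

End CompleteDual.

Section WeakBoundedness.
Context (R : realType) (V : normedModType R).

Lemma norming_functional (x : V) :
  exists2 f : dual V, `|f| <= 1 & `|x| <= f x.
Proof.
have [||f f_norm f_x] := @convex_separation R V [set 0] x.
- by exists 0.
- by move=> a b t; rewrite !inE /= => -> ->; rewrite convmm.
exists f; first by apply: clin_norm_le => // h; rewrite mul1r.
have := f_x 0 erefl; rewrite subr0 => /(le_trans _) -> //.
by rewrite /dist_set image_set1 inf1 subr0.
Qed.

(** Uniform boundedness of the evaluations at [u k], seen as functionals on the
    Banach space [dual V]; a norming functional turns a bound on the evaluations
    into a bound on the vectors. *)
Lemma weak_cvg_bounded (u : nat -> V) l :
  weak_cvg u l -> exists M, forall k, `|u k| <= M.
Proof.
move=> ul; pose ev k : dual V -> R^o := fun f => f (u k).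
have [_ [k _ <-]|f|M evM] := @Banach_Steinhauss R (dual V) R^o (range ev) _ _ 1.
- split=> [r|a f g //]; exists (r * `|u k|) => f fr.
  by apply: le_trans (clin_norm_apply f _) _; rewrite ler_wpM2r.
- have [M fM] := cvg_has_ub (cvgP _ (ul f)).
  by exists M => _ [k _ <-]; apply: fM; exists k.
exists M => k; have [f f1 fx] := norming_functional (u k).
apply: le_trans fx _; apply: le_trans (ler_norm _) _.
by apply: (evM (ev k)) => //; exists k.
Qed.

(** Mazur's theorem, for sequences. *)
Lemma weak_cvg_closed_convex (C : set V) u l : closed C -> convex_set C ->
  (forall k, C (u k)) -> weak_cvg u l -> C l.
Proof.
move=> clC cC Cu ul.
have C0 : C !=set0 by exists (u 0%N).
have [f f_norm f_sep] := convex_separation l C0 cC.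
apply: closed_dist_set0 => //.
have ful : (fun k => f (l - u k)) @ \oo --> (0 : R^o).
  rewrite -[X in _ --> X](subrr (f l)).
  rewrite (_ : (fun k => _) = (fun k => f l - f (u k))).
    by apply: cvgB; [exact: cvg_cst|exact: ul].
  by apply/funext => k; rewrite linearB.
apply: (cvgr_to_ge ful); apply: nearW => k; exact: f_sep.
Qed.

End WeakBoundedness.

(** * Projections in Hilbert spaces *)

Section Hilbert.
Context (R : realType) (H : hilbertType R).
Implicit Types a b h : H.

Lemma innerC a b : inner a b = inner b a.
Proof. by rewrite hermitian_subproof expr0 mul1r. Qed.

Lemma innerDl a b h : inner (a + b) h = inner a h + inner b h.
Proof. exact: linearDl. Qed.

Lemma innerDr a b h : inner h (a + b) = inner h a + inner h b.
Proof. exact: linearDr. Qed.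

Lemma innerZl (t : R) a h : inner (t *: a) h = t * inner a h.
Proof. by rewrite linearZl_LR. Qed.

Lemma innerZr (t : R) a h : inner h (t *: a) = t * inner h a.
Proof. by rewrite innerC innerZl innerC. Qed.

Lemma innerNl a h : inner (- a) h = - inner a h.
Proof. by rewrite -scaleN1r innerZl mulN1r. Qed.

Lemma innerNr a h : inner h (- a) = - inner h a.
Proof. by rewrite innerC innerNl innerC. Qed.

Definition innerE := (innerDl, innerDr, innerZl, innerZr, innerNl, innerNr).

Lemma cauchy_schwarz a b : inner a b <= `|a| * `|b|.
Proof.
have [->|b0] := eqVneq b 0.
  by rewrite -(scale0r a) innerZr scale0r normr0 mul0r mulr0.
have b_gt0 : 0 < `|b| by rewrite normr_gt0.
have : 0 <= inner (`|b| *: a - `|a| *: b) (`|b| *: a - `|a| *: b).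
  by rewrite innerxx sqr_ge0.
rewrite !innerE !innerxx (innerC b a).
have [->|a0] := eqVneq a 0.
  by rewrite innerC -(scale0r b) innerZr scale0r normr0 !mul0r.
have a_gt0 : 0 < `|a| by rewrite normr_gt0.
rewrite (_ : _ + _ = (2 * (`|a| * `|b|)) * (`|a| * `|b| - inner a b)).
  by rewrite pmulr_rge0 ?subr_ge0// !mulr_gt0.
by ring.
Qed.

Lemma parallelogram a b :
  `|a + b| ^+ 2 + `|a - b| ^+ 2 = 2 * (`|a| ^+ 2 + `|b| ^+ 2).
Proof. by rewrite -!innerxx !innerE (innerC b a); ring. Qed.

Lemma sqr_norm_subZ (t : R) a b :
  `|a - t *: b| ^+ 2 = `|a| ^+ 2 - t * (2 * inner a b - t * `|b| ^+ 2).
Proof. by rewrite -!innerxx !innerE (innerC b a); ring. Qed.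

(** A minimizing sequence is Cauchy: the midpoint of two of its terms lies in
    [A], hence is not closer to [h] than the infimum, and the parallelogram law
    bounds the distance between the two terms. *)
Lemma projection_exists (A : set H) h : A !=set0 -> closed A -> convex_set A ->
  exists2 p, A p & `|h - p| = dist_set A h.
Proof.
move=> A0 clA cA; pose d := dist_set A h; pose e (n : nat) : R := harmonic n.
have e0 n : 0 < e n by rewrite /e /= invr_gt0.
have e1 n : e n <= 1 by rewrite /e /= invf_le1// ler1n.
have /choice[a aP] n : exists a, A a /\ `|h - a| < d + e n.
  by have [a Aa ha] := dist_set_approx h A0 (e0 n); exists a.
have d0 : 0 <= d := dist_set_ge0 A h.
have aB m n : `|a m - a n| ^+ 2 <= (4 * d + 2) * (e m + e n).
  have [[Aam am] [Aan an]] := (aP m, aP n).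
  have := parallelogram (h - a n) (h - a m).
  have -> : h - a n - (h - a m) = a m - a n.
    by rewrite opprB addrC addrA subrK.
  have mid : 2 * d <= `|h - a n + (h - a m)|.
    have half01 : 0 <= (2^-1 : R) <= 1 by lra.
    have := dist_set_le h (convex_setP cA half01 Aam Aan).
    rewrite (_ : h - (_ + _) = 2^-1 *: (h - a n + (h - a m))); last first.
      have -> : 1 - 2^-1 = 2^-1 :> R by field.
      rewrite -scalerDr addrACA -opprD scalerBr -(mulr2n h).
      rewrite -(scaler_nat 2 h) scalerA.
      by rewrite mulVf ?pnatr_eq0// scale1r (addrC (a n)).
    by rewrite normrZ gtr0_norm ?invr_gt0// -ler_pdivrMl ?invr_gt0// invrK.
  have sq c x : 0 <= x -> x < d + c -> 0 <= c -> c <= 1 ->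
      x ^+ 2 <= d ^+ 2 + (2 * d + 1) * c.
    move=> x0 xdc c0 c1; rewrite (@le_trans _ _ ((d + c) ^+ 2))//.
      by rewrite ler_sqr ?nnegrE ?addr_ge0// ltW.
    have : c ^+ 2 <= c by rewrite expr2 ler_piMr.
    nra.
  have := sq _ _ (normr_ge0 _) am (ltW (e0 m)) (e1 m).
  have := sq _ _ (normr_ge0 _) an (ltW (e0 n)) (e1 n).
  have : (2 * d) ^+ 2 <= `|h - a n + (h - a m)| ^+ 2.
    by rewrite ler_sqr ?nnegrE// mulr_ge0.
  lra.
have a_cvg : cvg (a @ \oo).
  apply: cauchy_cvg; apply: cauchy_exP => r r0.
  have K0 : 0 < 4 * d + 2 by rewrite ltr_wpDl// mulr_ge0.
  have [N _ eN] : \forall n \near \oo, e n <= r ^+ 2 / (4 * (4 * d + 2)).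
    have /cvgr0_norm_le : e @ \oo --> (0 : R) by exact: cvg_harmonic.
    move=> /(_ (r ^+ 2 / (4 * (4 * d + 2)))).
    rewrite divr_gt0 ?exprn_gt0 ?mulr_gt0// => /(_ isT).
    by apply: filterS => n; rewrite ger0_norm// ltW.
  exists (a N); exists N => // n /= Nn; rewrite -ball_normE /=.
  rewrite -ltr_sqr ?nnegrE ?(ltW r0)//; apply: le_lt_trans (aB _ _) _.
  have := eN N (leqnn N); have := eN n Nn.
  rewrite !ler_pdivlMr ?mulr_gt0//.
  have := exprn_gt0 2 r0.
  nra.
have pA : A (lim (a @ \oo)).
  by apply: (closed_cvg _ clA _ _ a_cvg); apply: nearW => n; case: (aP n).
exists (lim (a @ \oo)) => //; apply/eqP; rewrite eq_le dist_set_le// andbT.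
have : (fun n => `|h - a n| - e n) @ \oo --> `|h - lim (a @ \oo)| - 0.
  apply: cvgB; last exact: cvg_harmonic.
  by apply: cvg_norm; apply: cvgB => //; exact: cvg_cst.
rewrite subr0 => /cvgr_to_le; apply; apply: nearW => n.
by rewrite lerBlDr ltW//; case: (aP n).
Qed.

Lemma proj_setP (A : set H) h : A !=set0 -> closed A -> convex_set A ->
  A (proj_set A h) /\ `|h - proj_set A h| = dist_set A h.
Proof.
move=> A0 clA cA; have [p Ap hp] := projection_exists h A0 clA cA.
by apply: (@getPex _ [set p | A p /\ `|h - p| = dist_set A h]); exists p.
Qed.

(** Otherwise, moving from the projection [p] a little towards [a] would come
    closer to [h]. *)
Lemma proj_set_obtuse (A : set H) h a : A !=set0 -> closed A -> convex_set A ->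
  A a -> inner (h - proj_set A h) (a - proj_set A h) <= 0.
Proof.
move=> A0 clA cA Aa; have [] := proj_setP h A0 clA cA.
set p := proj_set A h => Ap hp; rewrite leNgt; apply/negP.
set c := inner _ _ => c0.
set N := `|a - p| ^+ 2; have N0 : 0 <= N by exact: sqr_ge0.
have cN : 0 < c + N by rewrite ltr_wpDr.
(* This step satisfies both [t <= 1] and [t * N < 2 * c]. *)
pose t := c / (c + N).
have t01 : 0 <= t <= 1.
  by rewrite divr_ge0 ?(ltW c0) ?(ltW cN)//= ler_pdivrMr// mul1r lerDl.
have t0 : 0 < t by exact: divr_gt0.
have := dist_set_le h (convex_setP cA t01 Ap Aa); rewrite -hp.
rewrite (_ : h - (_ + _) = (h - p) - t *: (a - p)); last first.
  rewrite scalerBl scale1r scalerBr -addrA opprD addrA.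
  by rewrite (addrC (- (t *: p))).
rewrite -ler_sqr ?nnegrE// sqr_norm_subZ -/c -/N.
rewrite lerDl oppr_ge0 pmulr_rle0//.
have : t * N <= c by rewrite /t mulrAC ler_pdivrMr// ler_pM2l// lerDr ltW.
lra.
Qed.

End Hilbert.

(** Split [q - g] at the projection [P]: [q - P] makes an obtuse angle with the
    residual, and [P - g = w - r]. *)
Lemma proj_residual_inner_le (R : realType) (H : hilbertType R) (A : set H)
    (g w q : H) (r := g + w - proj_set A (g + w)) :
  A !=set0 -> closed A -> convex_set A -> A q ->
  inner r (q - g) <= inner r w - `|r| ^+ 2.
Proof.
move=> A0 clA cA Aq; have := proj_set_obtuse (g + w) A0 clA cA Aq.
have -> : q - g = (q - proj_set A (g + w)) + (w - r).
  suff -> : w - r = proj_set A (g + w) - g by rewrite subrKA.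
  by rewrite addrC opprB opprD addrA subrK.
rewrite -/r -innerxx [X in _ -> X <= _]innerDr [inner r (w - r)]innerDr.
by rewrite innerNr gerDr.
Qed.

(** * Linearization of concave constraints *)

Lemma recession_cone_iter (R : realType) (H : normedModType R) (A : set H) h a n :
  recession_cone A h -> A a -> A (a + n%:R *: h).
Proof.
move=> Ah Aa; elim: n => [|n IH]; first by rewrite scale0r addr0.
apply: Ah; exists (a + n%:R *: h) => //.
by rewrite mulrS scalerDl scale1r addrCA.
Qed.

Lemma cvg_diff_quotient (R : realType) (V W : normedModType R) (f df : V -> W)
    (a v : V) : is_diff a f df ->
  (fun n => n.+1%:R *: (f (n.+1%:R^-1 *: v + a) - f a)) @ \oo --> df v.
Proof.
move=> fdf; have fd : differentiable f a by exact: ex_diff.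
have harm0 : (@harmonic R) @ \oo --> (0 : R)^'.
  move=> U U0.
  have near_U : \forall n \near \oo, @harmonic R n != 0 -> U (harmonic n).
    exact: (@cvg_harmonic R _ U0).
  suff : \forall n \near \oo, U (@harmonic R n) by [].
  by apply: filterS near_U => n; apply; rewrite gt_eqF ?harmonic_gt0.
have dq : (fun h => h^-1 *: (f (h *: v + a) - f a)) @ (0 : R)^' --> df v.
  have -> : df v = 'D_v f a by rewrite deriveE// diff_val.
  have : derivable f a v by exact: diff_derivable.
  exact.
have := cvg_comp _ _ harm0 dq.
by rewrite /comp /=; under eq_fun do rewrite invrK.
Qed.

Section Linearization.
Context (R : realType) (X Y : normedModType R) (H : hilbertType R).
Context (i : clin Y H) (calK : set H) (G : X -> X -> Y).

(** Concavity transfers feasibility from [G x] to its linearization at [z]: with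
    step [n.+1%:R^-1], [n.+1] times the concavity defect is a recession
    direction, and adding it to [i (G x y)] gives [i (G x z)] plus a difference
    quotient that tends to [i (D (y - z))]. *)
Lemma linearization_mem (x y z : X) (D : clin X Y) :
  closed calK -> recession_concave i calK G -> is_diff z (G x) D ->
  calK (i (G x y)) -> calK (i (G x z) + i (D (y - z))).
Proof.
move=> clK Gc Gd Ky.
pose s n := i (G x z) +
  i (n.+1%:R *: (G x (n.+1%:R^-1 *: (y - z) + z) - G x z)).
have s_lim : s @ \oo --> i (G x z) + i (D (y - z)).
  apply: cvgD; first exact: cvg_cst.
  apply: (@continuous_cvg _ _ _ _ _ _ i); first exact: clin_continuous.
  exact: cvg_diff_quotient.
apply: (closed_cvg _ clK _ _ s_lim); apply: nearW => n.
have t01 : 0 <= (n.+1%:R^-1 : R) <= 1 by rewrite invr_ge0 ler0n invf_le1 ?ler1n.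
have := recession_cone_iter n.+1 (Gc x z y n.+1%:R^-1 t01) Ky.
congr calK; rewrite /s -linearZ -!linearD; congr (i _).
have -> : (1 - n.+1%:R^-1) *: z + n.+1%:R^-1 *: y = n.+1%:R^-1 *: (y - z) + z.
  by rewrite scalerBl scale1r scalerBr addrAC [RHS]addrC addrA.
rewrite !scalerBr !scalerA mulfV ?pnatr_eq0// scale1r.
rewrite mulrBr mulr1 mulfV ?pnatr_eq0// scalerBl scale1r opprB.
by rewrite subrKC addrCA.
Qed.

End Linearization.

(** * Decay of the constraint violation *)

Section AugmentedLagrangianMethod.
Context (R : realType) (X Y : normedModType R) (H : hilbertType R).
Context (i : clin Y H) (calK : set H).
Context (F : X -> dual X) (G : X -> X -> Y) (DyG : X -> X -> clin X Y).
Hypotheses (calK_neq0 : calK !=set0) (calK_closed : closed calK).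
Hypothesis calK_convex : convex_set calK.

(** The feasible point [y] serves as test point in the inexact variational
    inequality. By [linearization_mem], the derivative term then evaluates the
    residual in a direction that leads from [i (G x x)] to a point of [calK],
    where [proj_residual_inner_le] applies. *)
Lemma alm_residual_bound (C : set X) (K : set Y) (x y : X) (l : H) (rho : R)
    (e : dual X) :
  is_diff x (G x) (DyG x x) -> recession_concave i calK G ->
  i @^-1` calK = K -> 0 < rho ->
  normal_cone C x (e - aug_lagrangian i calK F G DyG rho x l) ->
  feasible_map G C K x y ->
  rho * `|alm_residual i calK G x l rho| ^+ 2 <=
    inner (alm_residual i calK G x l rho) l + (F x - e) (y - x).
Proof.
move=> Gd Gc KE rho0 nc [Cy Ky]; set r := alm_residual _ _ _ _ _ _.
have iKy : calK (i (G x y)) by rewrite -KE in Ky.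
have := proj_residual_inner_le (i (G x x)) (rho^-1 *: l)
  calK_neq0 calK_closed calK_convex (linearization_mem calK_closed Gc Gd iKy).
rewrite -/(alm_residual i calK G x l rho) -/r addrAC subrr add0r innerZr.
rewrite -(ler_pM2l rho0) mulrBr mulVKf ?gt_eqF//.
have : e (y - x) - (F x (y - x) + rho * inner r (i (DyG x x (y - x)))) <= 0.
  exact: (nc y Cy).
have -> : (F x - e) (y - x) = F x (y - x) - e (y - x) by [].
lra.
Qed.

Lemma dist_set_alm_V_le (x : X) (l : H) (rho : R) :
  dist_set calK (i (G x x)) <= alm_V i calK G x l rho.
Proof.
by apply: dist_set_le; exact: (proj_setP _ calK_neq0 calK_closed calK_convex).1.
Qed.

Lemma alm_V_le_residual (x : X) (l : H) (rho : R) : 0 < rho ->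
  alm_V i calK G x l rho <= `|alm_residual i calK G x l rho| + `|l| / rho.
Proof.
move=> rho0; rewrite /alm_V /alm_residual; set P := proj_set _ _.
rewrite (_ : i (G x x) - P = (i (G x x) + rho^-1 *: l - P) - rho^-1 *: l).
  apply: le_trans (ler_normB _ _) _; rewrite normrZ.
  by rewrite gtr0_norm ?invr_gt0// [_^-1 * _]mulrC.
by rewrite addrAC addrK.
Qed.

Section Updates.
Context (gamma tau : R) (B : set H) (x : nat -> X) (lam w : nat -> H).
Context (rho : nat -> R).
Hypotheses (gamma_gt1 : 1 < gamma) (tau_gt0 : 0 < tau) (tau_lt1 : tau < 1).
Hypothesis rho0_gt0 : 0 < rho 0%N.
Hypothesis alm : alm_updates i calK G gamma tau B x lam w rho.

Let V k := alm_V i calK G (x k.+1) (w k) (rho k).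

Lemma alm_rho_gt0 k : 0 < rho k.
Proof.
elim: k => // k IH; rewrite (alm_rho alm); case: ifP => // _.
by rewrite mulr_gt0// (lt_trans ltr01).
Qed.

Lemma alm_rho_nondecreasing : nondecreasing_seq rho.
Proof.
apply/nondecreasing_seqP => k; rewrite (alm_rho alm); case: ifP => // _.
by rewrite ler_peMl// ?ltW// alm_rho_gt0.
Qed.

(** Every penalty increase is at least [(gamma - 1) * rho 0]; if [rho] converges,
    the increases must stop, and from then on [V] decreases geometrically. *)
Lemma alm_V_cvg0 : cvgn rho -> V @ \oo --> (0 : R).
Proof.
move=> rho_cvg.
have step0 : (fun k => rho k.+1 - rho k) @ \oo --> (0 : R).
  rewrite -[X in _ --> X](subrr (lim (rho @ \oo))).
  by apply: cvgB => //; move: rho_cvg; rewrite -(cvg_shiftS rho).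
have gap_gt0 : 0 < (gamma - 1) * rho 0%N by rewrite mulr_gt0// subr_gt0.
have [N _ stepN] := cvgr_lt _ step0 _ gap_gt0.
have VS k : (N <= k)%N -> V k.+1 <= tau * V k.
  move=> Nk; have := stepN k.+1 (leqW Nk); rewrite /= (alm_rho alm k.+1) /=.
  case: ifP => // _; rewrite -{2}[rho k.+1]mul1r -mulrBl ltr_pM2l ?subr_gt0//.
  by rewrite ltNge (alm_rho_nondecreasing (leq0n k.+1)).
have Vgeo n : V (n + N)%N <= V N * tau ^+ n.
  elim: n => [|n IH]; first by rewrite expr0 mulr1.
  apply: le_trans (VS _ (leq_addl _ _)) _.
  by rewrite exprS mulrCA ler_pM2l.
rewrite -(cvg_shiftn N).
apply: (@squeeze_cvgr _ _ _ _ (cst 0) (fun n => V N * tau ^+ n)).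
- by apply: nearW => n; rewrite Vgeo andbT normr_ge0.
- exact: cvg_cst.
- rewrite -[X in _ --> X](mulr0 (V N)); apply: cvgM; first exact: cvg_cst.
  by apply: cvg_expr; rewrite gtr0_norm.
Qed.

End Updates.
End AugmentedLagrangianMethod.

(** Where [s k > e], the right-hand side is at most [(`|a| + `|b| / e) * s k],
    which forces [rho k <= (`|a| + `|b| / e) / e]. *)
Lemma quadratic_bound_cvg0 (R : realType) (rho s : nat -> R) (a b : R) :
  (forall k, 0 <= s k) -> rho @ \oo --> +oo ->
  (\forall k \near \oo, rho k * s k ^+ 2 <= a * s k + b) ->
  s @ \oo --> (0 : R).
Proof.
move=> s0 rho_oo sab; apply/cvgr0Pnorm_le => e e0.
have rho_big : \forall k \near \oo, (`|a| + `|b| / e) / e < rho k.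
  by have /cvgryPgt := rho_oo; exact.
apply: filterS2 sab rho_big => k sk rk; rewrite ger0_norm//.
rewrite leNgt; apply/negP => esk.
have sk0 : 0 < s k := lt_trans e0 esk.
move: sk; apply/negP; rewrite -ltNge.
have b_le : b <= `|b| / e * s k.
  rewrite (le_trans (ler_norm b))// mulrAC ler_pdivlMr// ler_wpM2l// ltW//.
have a_le : a * s k <= `|a| * s k by rewrite ler_wpM2r// ler_norm.
apply: (le_lt_trans (lerD a_le b_le)).
rewrite -mulrDl expr2 mulrA ltr_pM2r//.
have c0 : 0 <= `|a| + `|b| / e by rewrite addr_ge0// divr_ge0// ltW.
have rk0 : 0 <= rho k := le_trans (divr_ge0 c0 (ltW e0)) (ltW rk).
rewrite ltr_pdivrMr// in rk; apply: lt_le_trans rk _.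
by rewrite ler_wpM2l// ltW.
Qed.

(** * Weak limits of sequences *)

(** The subsequence is rewritten with indices of the form [(m k).+1], because
    only the iterates [x k.+1] satisfy the variational inequalities. *)
Lemma weak_limit_point_shift (R : realType) (X : normedModType R) (x : nat -> X)
    l : weak_limit_point x l ->
  exists2 m : nat -> nat, (forall k, (k <= m k)%N) &
    weak_cvg (fun k => x (m k).+1) l.
Proof.
move=> [phi phi_incr phi_cvg].
have phi_ge k : (k <= phi k)%N.
  by elim: k => // k IH; apply: leq_ltn_trans IH _; exact: phi_incr.
exists (fun k => (phi k.+1).-1) => [k|psi].
  by rewrite -ltnS prednK// (leq_ltn_trans _ (phi_ge k.+1)).
have := phi_cvg psi; rewrite -(cvg_shiftS (psi \o (x \o phi))).
apply: cvg_trans; apply: near_eq_cvg; apply: nearW => k /=.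
by rewrite prednK// (leq_ltn_trans _ (phi_ge k.+1)).
Qed.

Lemma cvg_subseq_oo (m : nat -> nat) :
  (forall k, (k <= m k)%N) -> m @ \oo --> \oo.
Proof.
move=> m_ge U [N _ NU]; exists N => // k /= Nk.
by apply: NU => /=; exact: leq_trans (m_ge k).
Qed.

Lemma weak_cvg_diag (R : realType) (X : normedModType R) (u : nat -> X) l :
  weak_cvg u l -> weak_cvg (fun k => (u k, u k)) (l, l).
Proof.
move=> ul psi.
have diagP : (fun a : X => (a, a)) \in @clin_pred R X (X * X)%type.
  by rewrite inE; split=> // a; exact: cvg_pair.
exact: (ul (CLin (clin_comp_subproof psi (CLin diagP)))).
Qed.

Lemma weakly_seq_lsc_cvg0 (R : realType) (V : normedModType R) (f : V -> R)
    (u : nat -> V) l : weakly_seq_lsc f -> weak_cvg u l ->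
  (f \o u) @ \oo --> (0 : R) -> f l <= 0.
Proof.
move=> flsc /flsc fl fu0; rewrite -lee_fin; apply: le_trans fl _.
have fu0E : (fun k => (f (u k))%:E) @ \oo --> 0%E.
  by apply: cvg_EFin => //; exact: nearW.
by rewrite (is_cvg_limn_einfE (cvgP _ fu0E)) (cvg_lim _ fu0E).
Qed.

(** * Feasibility of weak limit points *)

Theorem lemma6p2 (R : realType) (X Y : completeNormedModType R)
  (H : hilbertType R)
  (C : set X) (K : set Y)
  (C_neq0 : C !=set0) (C_closed : closed C) (C_convex : convex_set C)
  (K_neq0 : K !=set0) (K_closed : closed K) (K_convex : convex_set K)
  (i : clin Y H) (i_inj : injective i) (i_dense : dense (range i))
  (calK : set H) (calK_closed : closed calK) (calK_convex : convex_set calK)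
  (calK_preim : i @^-1` calK = K)
  (F : X -> dual X) (G : X -> X -> Y) (DyG : X -> X -> clin X Y)
  (G_diff : forall x y, is_diff y (G x) (DyG x y))
  (gamma tau : R) (gamma_gt1 : 1 < gamma) (tau_gt0 : 0 < tau) (tau_lt1 : tau < 1)
  (B : set H) (B_bounded : bounded_set B)
  (x : nat -> X) (lam w : nat -> H) (rho : nat -> R) (rho0_gt0 : 0 < rho 0%N)
  (alm : alm_updates i calK G gamma tau B x lam w rho)
  (F_bounded : bounded_operator F) (F_pseudo : pseudomonotone F)
  (Phi_mosco : weakly_mosco_continuous (feasible_map G C K))
  (G_concave : recession_concave i calK G)
  (dist_lsc : weakly_seq_lsc
    (fun p : X * X => dist_set calK (i (G p.1 p.2))))
  (eps : nat -> dual X)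
  (inexact : alm_inexact i calK F G DyG C x w rho eps)
  (xbar : X) (xbar_lim : weak_limit_point x xbar) :
  feasible_map G C K xbar !=set0 -> feasible_map G C K xbar xbar.
Proof.
move=> [y0 Phi_y0].
have calK_neq0 : calK !=set0.
  by case: Phi_y0 => _; rewrite -calK_preim => Ky; exists (i (G xbar y0)).
have [m m_ge u_cvg] := weak_limit_point_shift xbar_lim.
pose u k := x (m k).+1.
have m_oo := cvg_subseq_oo m_ge.
pose V k := alm_V i calK G (x k.+1) (w k) (rho k).
have rho_gt0 k : 0 < rho k by exact: alm_rho_gt0 alm _.
(* It suffices that [V] vanishes along the subsequence: weak lower semicontinuity
   of the distance and weak closedness of [C] conclude. *)
suff Vm0 : (V \o m) @ \oo --> (0 : R).
  have d0 : (fun k => dist_set calK (i (G (u k) (u k)))) @ \oo --> (0 : R).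
    apply: (@squeeze_cvgr _ _ _ _ (cst 0) (V \o m)) => //; last exact: cvg_cst.
    apply: nearW => k; rewrite dist_set_ge0/=.
    exact: dist_set_alm_V_le.
  split.
    apply: (weak_cvg_closed_convex C_closed C_convex _ u_cvg) => k.
    by case: inexact => /(_ (m k))[].
  rewrite -calK_preim; apply: (@closed_dist_set0 _ _ calK) => //.
  exact: (weakly_seq_lsc_cvg0 dist_lsc (weak_cvg_diag u_cvg) d0).
have [rho_cvg|rho_dvg] := pselect (cvgn rho).
  by apply: (cvg_comp _ _ m_oo); exact: (alm_V_cvg0 _ _ _ _ alm).
(* The penalty parameters diverge. Mosco-continuity provides feasible points [y k]
   for the moving constraints; being convergent, they are bounded. *)
have rho_oo : (rho \o m) @ \oo --> +oo.
  apply: (cvg_comp _ _ m_oo); apply: nondecreasing_dvgn_lt => //.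
  exact: alm_rho_nondecreasing alm.
have [y Phi_y y_cvg] := (Phi_mosco _ _ u_cvg).1 y0 Phi_y0.
have [Mu uM] := weak_cvg_bounded u_cvg.
have [My My0 yM] := pinfty_ex_gt0 (cvg_seq_bounded (cvgP _ y_cvg)).
have [Me Me0 eM] := pinfty_ex_gt0 (cvg_seq_bounded (cvgP _ inexact.2)).
have [Mw Mw0 wM] := pinfty_ex_gt0 B_bounded.
have [MF MF0 FM] : exists2 MF, 0 < MF & forall k, `|F (u k)| <= MF.
  have ub : bounded_set (range u).
    exists Mu; split=> [|M MuM _ [k _ <-]]; first exact: num_real.
    exact: le_trans (uM k) (ltW MuM).
  have [MF MF0 FM] := pinfty_ex_gt0 (F_bounded _ ub).
  by exists MF => // k; apply: FM; exists (u k) => //; exists k.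
pose r k := alm_residual i calK G (u k) (w (m k)) (rho (m k)).
have wMk k : `|w k| <= Mw by apply: wM; exact: alm_w alm k.
have r0 : (fun k => `|r k|) @ \oo --> (0 : R).
  apply: (@quadratic_bound_cvg0 _ (rho \o m) _ Mw ((MF + Me) * (My + Mu))) => //.
  apply: nearW => k.
  have := alm_residual_bound calK_neq0 calK_closed calK_convex (G_diff _ _)
    G_concave calK_preim (rho_gt0 (m k)) (inexact.1 (m k)).2 (Phi_y k).
  move=> /le_trans; apply; apply: lerD.
    apply: le_trans (cauchy_schwarz _ _) _; rewrite mulrC.
    by rewrite ler_wpM2r.
  apply: le_trans (ler_norm _) _; apply: le_trans (clin_norm_apply _ _) _.
  apply: ler_pM => //.
    apply: le_trans (ler_normB _ _) _; apply: lerD; first exact: FM.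
    exact: eM.
  apply: le_trans (ler_normB _ _) _; apply: lerD; last exact: uM.
  exact: yM.
apply: (@squeeze_cvgr _ _ _ _ (cst 0) (fun k => `|r k| + Mw * (rho (m k))^-1)).
- apply: nearW => k; rewrite normr_ge0/=.
  apply: le_trans (alm_V_le_residual _ _ _ _ _ (rho_gt0 _)) _.
  by rewrite lerD2l ler_wpM2r// invr_ge0 ltW.
- exact: cvg_cst.
- rewrite -[X in _ --> X]addr0; apply: cvgD => //.
  rewrite -[X in _ --> X](mulr0 Mw); apply: cvgM; first exact: cvg_cst.
  apply/(@gtr0_cvgV0 _ _ _ _ (rho \o m)) => //.
  by apply: nearW => k; exact: rho_gt0.
Qed.
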